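(* Let $n\geq 1$ be an integer. Then for all real $x$ with $0<|x|<1$ the following three identities hold: $${}_2F_1(1,2;n+2;x)=(-1)^n\frac{n+1}{x^{n+1}}\left\{(1-x)^{n-1}\left[x+n\log(1-x)\right]-\sum_{j=1}^{n-1}(-1)^j\frac{n-j}{j}x^j(1-x)^{n-j-1}\right\},$$ $${}_2F_1(1,2;n+2;x)=(-1)^n\frac{n+1}{x^{n+1}}\left\{(1-x)^{n-1}\left[x+n\log(1-x)\right]+\sum_{i=2}^{n}\frac{(-1)^i}{i-1}\binom{n}{i}\left[(1-x)^{n-i}-(1-x)^{n-1}\right]\right\},$$ $${}_2F_1(1,2;n+2;x)=(-1)^n\frac{n(n+1)}{x^{n+1}}\left\{(1-x)^{n-1}\log(1-x)+\sum_{j=1}^{n-1}x^j\sum_{i=0}^{j-1}\frac{(-1)^i}{j-i}\binom{n-1}{i}\right\}-\frac{n+1}{x}.$$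
   Context: $(r)_0:=1$ and $(r)_j:=r(r+1)\cdots(r+j-1)$ for $j\ge 1$. The hypergeometric function is ${}_2F_1(a,b;c;x)=\sum_{j=0}^\infty \frac{(a)_j(b)_j}{(c)_j\,j!}x^j$ for $|x|<1$. Empty sums are $0$. *)

(* Defs.v *)
From Stdlib Require Import Reals Factorial.
From Coquelicot Require Import Coquelicot.
Open Scope R_scope.

Fixpoint pochhammer (r : R) (j : nat) : R :=
  match j with
  | O => 1
  | S k => pochhammer r k * (r + INR k)
  end.

(* Meaningful when c is not a nonpositive integer and |x| < 1; elsewhere the
   totalized operators of Rdiv and PSeries give unspecified values. *)
Definition hyp2F1 (a b c x : R) : R :=
  PSeries (fun j => pochhammer a j * pochhammer b j
                    / (pochhammer c j * INR (fact j))) x.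

(* Binomial coefficient; the unqualified name C is Coquelicot's type of
   complex numbers. *)
Notation binom := Binomial.C (only parsing).

(* Main.v *)
(** Write F_n = 2F1(1,2;n+2;x) = (-1)^n (n+1) / x^(n+1) B_n.  The contiguous
    relation n x F_(n+1) / (n+2) + (1-x) F_n = 1 becomes
    n B_(n+1) = (n+1) (1-x) B_n + (-x)^(n+1), with B_1 = x + ln (1-x).
    Each of the three closed forms satisfies this first-order recurrence: the
    inhomogeneous term comes from a geometric sum for the first, from the
    binomial theorem for the second, and from Pascal's rule for the third. *)

Require Import Defs.
From Stdlib Require Import Reals Factorial Lra Lia.
From Coquelicot Require Import Coquelicot.
Open Scope R_scope.

(* Coquelicot leaves equations at an algebraic structure's carrier, on which
   [ring] and [field] fail. *)
Ltac R_eq := match goal with |- ?a = ?b => change (@eq R a b) end.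

(** * Pochhammer symbols and the logarithm series *)

Lemma pochhammer_pos (r : R) (j : nat) : 0 < r -> 0 < pochhammer r j.
Proof.
  intros Hr; induction j as [|j IH]; simpl; [lra|].
  pose proof (pos_INR j); nra.
Qed.

Lemma pochhammer_1 (j : nat) : pochhammer 1 j = INR (fact j).
Proof.
  induction j as [|j IH]; [reflexivity|].
  rewrite fact_simpl, mult_INR, S_INR; simpl; rewrite IH; ring.
Qed.

(** Links the parameters [r] and [r + 1]; the definition only extends the product at its far end. *)
Lemma pochhammer_S (r : R) (j : nat) :
  pochhammer r (S j) = r * pochhammer (r + 1) j.
Proof.
  induction j as [|j IH]; [simpl; ring|].
  change (pochhammer r (S j) * (r + INR (S j))
          = r * (pochhammer (r + 1) j * (r + 1 + INR j))).
  rewrite IH, S_INR; ring.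
Qed.

(** Term-by-term integration of the geometric series from 0 to [x]. The coefficients of
    [PS_Int (fun _ => 1)] are 0, 1, 1/2, 1/3, ... *)
Lemma is_pseries_ln (x : R) :
  Rabs x < 1 -> is_pseries (PS_Int (fun _ => 1)) x (- ln (1 - x)).
Proof.
  intros Hx.
  assert (Hgeom : forall t, Rabs t < 1 ->
            is_pseries (fun _ => 1) t (/ (1 - t))).
  { intros t Ht; apply is_pseries_R.
    apply (is_series_ext (fun k => t ^ k)).
    - intros k; symmetry; apply Rmult_1_l.
    - now apply is_series_geom. }
  assert (Hcv : Rbar_lt (Rabs x) (CV_radius (fun _ : nat => 1))).
  (* The midpoint of |x| and 1 supplies the strict inequality, and its powers stay bounded by 1. *)
  { apply Rbar_lt_le_trans with ((Rabs x + 1) / 2); [simpl; lra|].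
    destruct (CV_radius_bounded (fun _ => 1)) as [Hub _].
    apply Hub; exists 1; intros k.
    rewrite Rmult_1_l, <- RPow_abs.
    apply Rle_trans with (1 ^ k); [apply pow_incr | rewrite pow1; lra].
    pose proof (Rabs_pos x); rewrite Rabs_pos_eq; lra. }
  replace (- ln (1 - x)) with (RInt (PSeries (fun _ => 1)) 0 x);
    [now apply is_pseries_RInt|].
  assert (Hin : forall t, Rmin 0 x <= t <= Rmax 0 x -> Rabs t < 1).
  { intros t; unfold Rmin, Rmax; apply Rabs_def2 in Hx.
    intros Ht; apply Rabs_def1; destruct (Rle_dec 0 x); lra. }
  (* The vanishing term [- ln (1 - 0)] turns the value into an increment of the primitive. *)
  replace (- ln (1 - x)) with (minus (- ln (1 - x)) (- ln (1 - 0))).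
  2:{ unfold minus, plus, opp; simpl; rewrite Rminus_0_r, ln_1; ring. }
  apply is_RInt_unique.
  apply (is_RInt_ext (fun t => / (1 - t))).
  { intros t Ht; symmetry; apply is_pseries_unique, Hgeom, Hin; lra. }
  apply (is_RInt_derive (fun t => - ln (1 - t)) (fun t => / (1 - t))).
  - intros t Ht; apply Hin, Rabs_def2 in Ht.
    auto_derive; [lra | field; lra].
  - intros t Ht; apply Hin, Rabs_def2 in Ht.
    apply (ex_derive_continuous (fun t => / (1 - t))).
    auto_derive; lra.
Qed.

(** * The contiguous relation and the recurrence for closed forms *)

Definition coef (n j : nat) : R := pochhammer 2 j / pochhammer (INR n + 2) j.

(* The contiguous relation of the header, coefficientwise. *)
Lemma coef_step (n j : nat) : (1 <= n)%nat ->
  coef (S n) j = (INR n + 2) / INR n * (coef n j - coef n (S j)).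
Proof.
  intros Hn; unfold coef.
  assert (0 < INR n) by (apply lt_0_INR; lia).
  pose proof (pos_INR j).
  pose proof (pochhammer_pos (INR n + 2) j ltac:(lra)).
  assert (E : pochhammer (INR (S n) + 2) j
              = pochhammer (INR n + 2) j * (INR n + 2 + INR j) / (INR n + 2)).
  { change (pochhammer (INR n + 2) j * (INR n + 2 + INR j))
      with (pochhammer (INR n + 2) (S j)).
    rewrite pochhammer_S, S_INR.
    replace (INR n + 1 + 2) with (INR n + 2 + 1) by ring; field; lra. }
  rewrite E; simpl; field; repeat split; lra.
Qed.

(** Induction on n for the statement with [is_pseries], which carries convergence along with the
    value. Summing [coef_step] against x^j gives F_(n+1) = (n+2)/n (F_n - (F_n - 1)/x). [B] stays
    abstract to serve all three closed forms. *)
Lemma hyp2F1_closed_form (B : nat -> R) (x : R) :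
  0 < Rabs x < 1 ->
  B 1%nat = x + ln (1 - x) ->
  (forall n, (1 <= n)%nat ->
     INR n * B (S n) = (INR n + 1) * (1 - x) * B n + (- x) ^ S n) ->
  forall n, (1 <= n)%nat ->
    hyp2F1 1 2 (INR n + 2) x
    = (-1) ^ n * ((INR n + 1) / x ^ (n + 1)) * B n.
Proof.
  intros Hx HB1 HB n Hn.
  assert (x0 : x <> 0) by (intros ->; rewrite Rabs_R0 in Hx; lra).
  unfold hyp2F1; apply is_pseries_unique.
  (* The factor (1)_j cancels j!, which leaves [coef n j]. *)
  apply (is_pseries_ext (coef n)).
  { intros j; unfold coef; rewrite pochhammer_1.
    pose proof (pos_INR n); pose proof (INR_fact_neq_0 j).
    pose proof (pochhammer_pos (INR n + 2) j ltac:(lra)).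
    R_eq; field; split; lra. }
  induction Hn as [|n Hn IH].
  (* For n = 1 the coefficients are 2/(j+2): the logarithm series is stripped of its first two
     terms, divided by x^2 and doubled. *)
  - pose proof (is_pseries_ln x (proj2 Hx)) as H.
    apply (is_pseries_decr_1 _ x (/ x)) in H; [|now apply Rinv_l].
    apply (is_pseries_decr_1 _ x (/ x)) in H; [|now apply Rinv_l].
    apply (is_pseries_scal 2) in H; [|apply Rmult_comm].
    replace ((-1) ^ 1 * ((INR 1 + 1) / x ^ (1 + 1)) * B 1%nat)
      with (scal 2 (scal (/ x)
              (plus (scal (/ x) (plus (- ln (1 - x)) (opp (PS_Int (fun _ => 1) 0%nat))))
                    (opp (PS_decr_1 (PS_Int (fun _ => 1)) 0%nat))))).
    2:{ rewrite HB1; unfold scal, plus, opp, PS_decr_1; simpl.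
        unfold mult; simpl; R_eq; field; assumption. }
    refine (is_pseries_ext _ _ _ _ _ H); intros j.
    unfold PS_scal, PS_decr_1, coef, scal; simpl; unfold mult; simpl.
    assert (E : pochhammer (1 + 2) j = pochhammer 2 (S j) / 2).
    { rewrite pochhammer_S; replace (2 + 1) with (1 + 2) by ring; field. }
    rewrite E; simpl.
    pose proof (pochhammer_pos 2 j ltac:(lra)); pose proof (pos_INR j).
    destruct j as [|j]; R_eq; [simpl; field|].
    rewrite !S_INR in *; field; repeat split; lra.
  - assert (0 < INR n) by (apply lt_0_INR; lia).
    pose proof (is_pseries_decr_1 _ x (/ x) _ (Rinv_l x x0) IH) as H1.
    pose proof (is_pseries_minus _ _ _ _ _ IH H1) as H2.
    apply (is_pseries_scal ((INR n + 2) / INR n)) in H2; [|apply Rmult_comm].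
    match type of H2 with is_pseries _ _ ?l =>
      replace ((-1) ^ S n * ((INR (S n) + 1) / x ^ (S n + 1)) * B (S n)) with l
    end.
    2:{ replace (B (S n)) with ((INR n * B (S n)) / INR n) by (field; lra).
        rewrite HB by assumption.
        unfold scal, plus, opp, coef; simpl; unfold mult; simpl.
        replace (match n with O => 1 | S _ => INR n + 1 end) with (INR n + 1)
          by (destruct n; simpl; ring).
        replace ((- x) ^ n) with ((-1) ^ n * x ^ n)
          by (rewrite <- Rpow_mult_distr; f_equal; ring).
        assert (E : (-1) ^ n * (-1) ^ n = 1)
          by (rewrite <- Rpow_mult_distr; replace (-1 * -1) with 1 by ring; apply pow1).
        assert (x ^ n <> 0) by now apply pow_nonzero.
        rewrite pow_add; simpl.
        (* The sign becomes an opaque [p], so that [field] can use p p = 1 as a rewriting rule. *)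
        revert E; generalize ((-1) ^ n); intros p E; R_eq.
        field [E]; repeat split; (assumption || lra). }
    refine (is_pseries_ext _ _ _ _ _ H2); intros j.
    rewrite coef_step by assumption.
    unfold PS_scal, PS_minus, PS_plus, PS_opp, PS_decr_1, scal, plus, opp; simpl.
    unfold mult; simpl; R_eq; ring.
Qed.

(** * Finite sums and binomial coefficients *)

Lemma sum_n_m_last (u : nat -> R) (a b : nat) : (a <= S b)%nat ->
  sum_n_m u a (S b) = sum_n_m u a b + u (S b).
Proof. intros H; now rewrite sum_n_Sm. Qed.

Lemma sum_n_m_first (u : nat -> R) (a b : nat) : (a <= b)%nat ->
  sum_n_m u a b = u a + sum_n_m u (S a) b.
Proof. exact (sum_Sn_m u a b). Qed.

(** Sums are compared below by matching summands inside linear combinations; a side with a single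
    sum is padded by a zero coefficient. *)
Lemma sum_n_m_lin (c d : R) (u v : nat -> R) (a b : nat) :
  sum_n_m (fun k => c * u k + d * v k) a b
  = c * sum_n_m u a b + d * sum_n_m v a b.
Proof.
  etransitivity.
  - exact (sum_n_m_plus (fun k => c * u k) (fun k => d * v k) a b).
  - apply (f_equal2 Rplus); apply (sum_n_m_mult_l (K := R_Ring)).
Qed.

(** The binomial theorem for -1 + y. It also serves at y = 1, where the sum vanishes for N >= 1. *)
Lemma sum_alternating_binomial (N : nat) (y : R) :
  sum_n_m (fun i => (-1) ^ i * binom N i * y ^ (N - i)) 0 N = (y - 1) ^ N.
Proof.
  replace (y - 1) with (-1 + y) by ring.
  rewrite binomial, <- sum_n_Reals; unfold sum_n.
  apply sum_n_m_ext_loc; intros k _; R_eq; ring.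
Qed.

(** Both sides equal (n+1)! / (i! (n-i)!). *)
Lemma binom_S_weighted (n i : nat) : (i <= n)%nat ->
  (INR n + 1) * binom n i = (INR n + 1 - INR i) * binom (S n) i.
Proof.
  intros Hi; unfold Binomial.C.
  rewrite (Nat.sub_succ_l i n Hi), !fact_simpl, !mult_INR, !S_INR, minus_INR by assumption.
  pose proof (INR_fact_neq_0 i); pose proof (INR_fact_neq_0 (n - i)).
  apply le_INR in Hi; field; repeat split; (assumption || lra).
Qed.

Lemma binom_diag (n : nat) : binom n n = 1.
Proof.
  unfold Binomial.C; rewrite Nat.sub_diag; simpl.
  field; apply INR_fact_neq_0.
Qed.

Lemma binom_0 (n : nat) : binom n 0 = 1.
Proof.
  unfold Binomial.C; rewrite Nat.sub_0_r; simpl.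
  field; apply INR_fact_neq_0.
Qed.

(** * The sum in the first closed form *)

(** The usual denominator (1 - x) - (- x) of such a geometric sum equals 1. *)
Lemma geometric_sum (x : R) (n : nat) :
  sum_n_m (fun j => (- x) ^ j * (1 - x) ^ (n - j)) 1 n
  = - x * (1 - x) ^ n - (- x) ^ S n.
Proof.
  induction n as [|n IH].
  - rewrite sum_n_m_zero by lia; unfold zero; simpl; ring.
  - rewrite sum_n_m_last, Nat.sub_diag by lia.
    rewrite (sum_n_m_ext_loc _
      (fun j => (1 - x) * ((- x) ^ j * (1 - x) ^ (n - j))
                + 0 * 0)).
    + rewrite (sum_n_m_lin _ _ _ (fun _ => 0)), IH; simpl; ring.
    + intros k Hk; rewrite Nat.sub_succ_l by lia; simpl; R_eq; ring.
Qed.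

(** With n = m + 1, n (n+1-j)/j = (n+1)(n-j)/j + 1, so the summands differ by those of
    [geometric_sum]. The term -x (1-x)^n offsets the defect of the logarithmic part of the
    bracket. *)
Lemma bracket1_step (x : R) (m : nat) :
  (INR m + 1) * sum_n_m (fun j => (-1) ^ j * ((INR (S (S m)) - INR j) / INR j)
                           * x ^ j * (1 - x) ^ (S (S m) - j - 1)) 1 (S m)
  = (INR m + 2) * (1 - x)
      * sum_n_m (fun j => (-1) ^ j * ((INR (S m) - INR j) / INR j)
                           * x ^ j * (1 - x) ^ (S m - j - 1)) 1 m
    - x * (1 - x) ^ S m - (- x) ^ S (S m).
Proof.
  pose proof (geometric_sum x (S m)) as G.
  rewrite sum_n_m_last, Nat.sub_diag in G by lia.
  (* The term j = n has weight 1/n and yields (-x)^n, the last term of the geometric sum. *)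
  rewrite sum_n_m_last by lia.
  replace (S (S m) - S m - 1)%nat with 0%nat by lia.
  match goal with |- _ * (?s + _) = _ * ?t - _ - _ =>
    assert (E : (INR m + 1) * s
      = (INR m + 2) * (1 - x) * t
        + 1 * sum_n_m (fun j => (- x) ^ j * (1 - x) ^ (S m - j)) 1 m)
  end.
  { rewrite <- sum_n_m_lin.
    match goal with |- _ * ?s = _ =>
      replace ((INR m + 1) * s) with ((INR m + 1) * s + 0 * s) by ring end.
    rewrite <- sum_n_m_lin.
    apply sum_n_m_ext_loc; intros k Hk; R_eq.
    replace (S (S m) - k - 1)%nat with (S (m - k)) by lia.
    replace (S m - k - 1)%nat with (m - k)%nat by lia.
    replace (S m - k)%nat with (S (m - k)) by lia.
    replace ((- x) ^ k) with ((-1) ^ k * x ^ k)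
      by (rewrite <- Rpow_mult_distr; f_equal; ring).
    assert (INR k <> 0) by (apply not_0_INR; lia).
    rewrite !S_INR; simpl; field; assumption. }
  replace ((- x) ^ S m) with ((-1) ^ S m * x ^ S m) in G
    by (rewrite <- Rpow_mult_distr; f_equal; ring).
  assert (INR (S m) <> 0) by (apply not_0_INR; lia).
  replace ((INR (S (S m)) - INR (S m)) / INR (S m)) with (/ (INR m + 1))
    by (rewrite !S_INR in *; field; assumption).
  rewrite S_INR in H.
  rewrite Rmult_plus_distr_l, E.
  replace ((INR m + 1) * ((-1) ^ S m * / (INR m + 1) * x ^ S m * (1 - x) ^ 0))
    with ((-1) ^ S m * x ^ S m * (1 - x) ^ 0) by (field; assumption).
  lra.
Qed.

(** * The sum in the second closed form *)

(** Here y stands for 1 - x. By [binom_S_weighted] the weights of the two sums differ by n - (n+1-i)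
    = i - 1, which cancels the denominator; the binomial theorem evaluates what remains. *)
Lemma bracket2_step (y : R) (n : nat) : (1 <= n)%nat ->
  INR n * sum_n_m (fun i => (-1) ^ i / (INR i - 1) * binom (S n) i
                      * (y ^ (S n - i) - y ^ n)) 2 (S n)
  = (INR n + 1) * y
      * sum_n_m (fun i => (-1) ^ i / (INR i - 1) * binom n i
                      * (y ^ (n - i) - y ^ (n - 1))) 2 n
    + (y - 1) ^ S n - (y - 1) * y ^ n.
Proof.
  intros Hn.
  assert (D : sum_n_m (fun i => (-1) ^ i * binom (S n) i * (y ^ (S n - i) - y ^ n)) 2 (S n)
              = (y - 1) ^ S n - (y - 1) * y ^ n).
  { pose proof (sum_alternating_binomial (S n) y) as By.
    pose proof (sum_alternating_binomial (S n) 1) as B1.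
    assert (E : sum_n_m (fun i => (-1) ^ i * binom (S n) i * (y ^ (S n - i) - y ^ n)) 0 (S n)
       = 1 * (y - 1) ^ S n + - y ^ n * (1 - 1) ^ S n).
    { rewrite <- By, <- B1, <- sum_n_m_lin.
      apply sum_n_m_ext; intros k; R_eq; rewrite pow1; ring. }
    (* The summand at i = 1 is zero and the one at i = 0 is (y - 1) y^n. *)
    rewrite 2!sum_n_m_first in E by lia.
    rewrite binom_0, Nat.sub_0_r in E.
    replace (S n - 1)%nat with n in E by lia.
    simpl in E |- *; lra. }
  enough (E : INR n * sum_n_m (fun i => (-1) ^ i / (INR i - 1) * binom (S n) i
                      * (y ^ (S n - i) - y ^ n)) 2 (S n)
     = (INR n + 1) * y
        * sum_n_m (fun i => (-1) ^ i / (INR i - 1) * binom n i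
                      * (y ^ (n - i) - y ^ (n - 1))) 2 n
       + 1 * sum_n_m (fun i => (-1) ^ i * binom (S n) i * (y ^ (S n - i) - y ^ n)) 2 (S n)).
  { rewrite E, D; ring. }
  (* The term i = n + 1 is absent from the sum over row n; there i - 1 = n, and the other two sums
     contribute equally. *)
  rewrite !(sum_n_m_last _ 2 n) by lia.
  rewrite Rmult_plus_distr_l.
  assert (0 < INR n) by (apply lt_0_INR; lia).
  match goal with |- ?a * ?s + _ = ?b * ?t + 1 * (?u + _) =>
    assert (E : a * s + 0 * s = b * t + 1 * u) end.
  { rewrite <- !sum_n_m_lin; apply sum_n_m_ext_loc; intros k Hk; R_eq.
    rewrite (Nat.sub_succ_l k n) by lia.
    replace (binom n k) with ((INR n + 1 - INR k) * binom (S n) k / (INR n + 1))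
      by (rewrite <- binom_S_weighted by lia; field; lra).
    replace (y ^ n) with (y * y ^ (n - 1))
      by (change (y ^ S (n - 1) = y ^ n); f_equal; lia).
    assert (2 <= INR k) by (apply (le_INR 2); lia).
    simpl; field; lra. }
  rewrite Rmult_0_l, Rplus_0_r in E; rewrite E.
  rewrite binom_diag, Nat.sub_diag, S_INR; field; lra.
Qed.

(** * The sum in the third closed form *)

(** For 1 <= j <= N+1, the coefficient of x^j in -(1-x)^N ln(1-x), as a Cauchy product. The upper
    bound matters because [binom N i] is nonzero for i > N. *)
Definition conv (N j : nat) : R :=
  sum_n_m (fun i => (-1) ^ i / (INR j - INR i) * binom N i) 0 (j - 1).

(** C(N,i)/(N+1-i) = C(N+1,i)/(N+1), and the alternating sum of row N+1 is 0, so all its terms but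
    the last add up to (-1)^N. *)
Lemma conv_diag (N : nat) : conv N (S N) = (-1) ^ N / (INR N + 1).
Proof.
  unfold conv; rewrite Nat.sub_succ, Nat.sub_0_r.
  pose proof (sum_alternating_binomial (S N) 1) as B1.
  rewrite sum_n_m_last, binom_diag, Nat.sub_diag in B1 by lia.
  pose proof (pos_INR N).
  rewrite (sum_n_m_ext_loc _
    (fun i => / (INR N + 1) * ((-1) ^ i * binom (S N) i * 1 ^ (S N - i)) + 0 * 0)).
  - rewrite (sum_n_m_lin _ _ _ (fun _ => 0)).
    match goal with |- _ * ?s + _ = _ => replace s with ((-1) ^ N) end.
    + field; lra.
    + simpl in *; lra.
  - intros k Hk; R_eq; rewrite pow1, S_INR.
    replace (binom N k) with ((INR N + 1 - INR k) * binom (S N) k / (INR N + 1))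
      by (rewrite <- binom_S_weighted by lia; field; lra).
    assert (INR k <= INR N) by (apply le_INR; lia).
    field; lra.
Qed.

Lemma conv_1 (N : nat) : conv N 1 = 1.
Proof.
  unfold conv; simpl; rewrite sum_n_n, binom_0; R_eq; simpl; field.
Qed.

(** Reflects multiplication by 1 - x. The terms i = 0 agree, and Pascal's rule gives the others
    after an index shift; j <= N keeps each binomial within its row. *)
Lemma conv_pascal (N j : nat) : (1 <= j <= N)%nat ->
  conv (S N) (S j) = conv N (S j) - conv N j.
Proof.
  destruct j as [|j]; [lia|]; intros Hj; unfold conv.
  rewrite !Nat.sub_succ, !Nat.sub_0_r, !(sum_n_m_first _ 0 (S j)) by lia.
  rewrite <- !sum_n_m_S, !binom_0.
  match goal with |- ?a + ?s = ?a + ?t - ?u =>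
    enough (E : 1 * s + 0 * s = 1 * t + -1 * u) by lra end.
  rewrite <- !sum_n_m_lin; apply sum_n_m_ext_loc; intros k Hk; R_eq.
  rewrite <- pascal by lia.
  assert (INR k <= INR j) by (apply le_INR; lia).
  rewrite !S_INR; simpl; field; lra.
Qed.

(** The left sum and 1 - x times the right one agree in every degree except m+1, where the left has
    an extra [conv m (S m)], evaluated by [conv_diag]. *)
Lemma bracket3_step (x : R) (m : nat) :
  sum_n_m (fun j => x ^ j * conv (S m) j) 1 (S m)
  = (1 - x) * sum_n_m (fun j => x ^ j * conv m j) 1 m
    + (-1) ^ m * x ^ S m / (INR m + 1).
Proof.
  destruct m as [|m].
  - rewrite sum_n_n, sum_n_m_zero, conv_1 by lia; unfold zero; simpl; R_eq; field.
  - assert (E : sum_n_m (fun j => x ^ j * conv (S (S m)) j) 2 (S (S m))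
       = 1 * sum_n_m (fun j => x ^ j * conv (S m) j) 2 (S (S m))
         + - x * sum_n_m (fun j => x ^ j * conv (S m) j) 1 (S m)).
    { rewrite <- !(sum_n_m_S _ 1 (S m)), <- sum_n_m_lin.
      apply sum_n_m_ext_loc; intros k Hk; R_eq.
      rewrite conv_pascal by lia; simpl; ring. }
    rewrite (sum_n_m_first _ 1) by lia; rewrite E.
    pose proof (sum_n_m_last (fun j => x ^ j * conv (S m) j) 1 (S m) ltac:(lia)) as L.
    cbv beta in L; rewrite conv_diag in L.
    rewrite (sum_n_m_first _ 1 (S (S m))) in L by lia.
    rewrite !conv_1 in *; unfold Rdiv in *; lra.
Qed.

(** * Verification of the recurrence for the three brackets *)

Theorem theorem4p1 (n : nat) (hn : (1 <= n)%nat) (x : R)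
    (hx : 0 < Rabs x < 1) :
  hyp2F1 1 2 (INR n + 2) x =
    (-1) ^ n * ((INR n + 1) / x ^ (n + 1)) *
      ((1 - x) ^ (n - 1) * (x + INR n * ln (1 - x))
       - sum_n_m (fun j => (-1) ^ j * ((INR n - INR j) / INR j)
                           * x ^ j * (1 - x) ^ (n - j - 1)) 1 (n - 1))
  /\
  hyp2F1 1 2 (INR n + 2) x =
    (-1) ^ n * ((INR n + 1) / x ^ (n + 1)) *
      ((1 - x) ^ (n - 1) * (x + INR n * ln (1 - x))
       + sum_n_m (fun i => (-1) ^ i / (INR i - 1) * binom n i
                           * ((1 - x) ^ (n - i) - (1 - x) ^ (n - 1))) 2 n)
  /\
  hyp2F1 1 2 (INR n + 2) x =
    (-1) ^ n * (INR n * (INR n + 1) / x ^ (n + 1)) *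
      ((1 - x) ^ (n - 1) * ln (1 - x)
       + sum_n_m (fun j => x ^ j *
           sum_n_m (fun i => (-1) ^ i / (INR j - INR i) * binom (n - 1) i)
             0 (j - 1)) 1 (n - 1))
    - (INR n + 1) / x.
Proof.
  split; [|split].
  - pose (B := fun n => (1 - x) ^ (n - 1) * (x + INR n * ln (1 - x))
       - sum_n_m (fun j => (-1) ^ j * ((INR n - INR j) / INR j)
                           * x ^ j * (1 - x) ^ (n - j - 1)) 1 (n - 1)).
    apply (hyp2F1_closed_form B); [assumption | | | assumption]; unfold B.
    + rewrite sum_n_m_zero by lia; unfold zero; simpl; ring.
    + intros k Hk; destruct k as [|m]; [lia|].
      replace (S (S m) - 1)%nat with (S m) by lia.
      replace (S m - 1)%nat with m by lia.
      generalize (bracket1_step x m).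
      match goal with |- _ * ?s = _ * ?t - _ - _ -> _ => generalize s t end.
      intros s t E; rewrite !S_INR, Rmult_minus_distr_l, E; simpl; ring.
  - pose (B := fun n => (1 - x) ^ (n - 1) * (x + INR n * ln (1 - x))
       + sum_n_m (fun i => (-1) ^ i / (INR i - 1) * binom n i
                           * ((1 - x) ^ (n - i) - (1 - x) ^ (n - 1))) 2 n).
    apply (hyp2F1_closed_form B); [assumption | | | assumption]; unfold B.
    + rewrite sum_n_m_zero by lia; unfold zero; simpl; ring.
    + intros k Hk.
      replace (S k - 1)%nat with k by lia.
      rewrite Rmult_plus_distr_l, bracket2_step by assumption.
      replace (1 - x - 1) with (- x) by ring.
      destruct k as [|m]; [lia|].
      replace (S m - 1)%nat with m by lia.
      rewrite !S_INR; simpl pow; ring.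
  - (* Here [n] times the new bracket exceeds the previous ones by [(- x) ^ n],
       which accounts for the extra term [- (n + 1) / x]. *)
    pose (B := fun n => INR n * ((1 - x) ^ (n - 1) * ln (1 - x)
       + sum_n_m (fun j => x ^ j * conv (n - 1) j) 1 (n - 1)) - (- x) ^ n).
    rewrite (hyp2F1_closed_form B); [ | assumption | | | assumption]; unfold B.
    + change (sum_n_m (fun j => x ^ j *
           sum_n_m (fun i => (-1) ^ i / (INR j - INR i) * binom (n - 1) i)
             0 (j - 1)) 1 (n - 1))
        with (sum_n_m (fun j => x ^ j * conv (n - 1) j) 1 (n - 1)).
      assert (x0 : x <> 0) by (intros ->; rewrite Rabs_R0 in hx; lra).
      replace ((- x) ^ n) with ((-1) ^ n * x ^ n)
        by (rewrite <- Rpow_mult_distr; f_equal; ring).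
      assert (E : (-1) ^ n * (-1) ^ n = 1)
        by (rewrite <- Rpow_mult_distr; replace (-1 * -1) with 1 by ring; apply pow1).
      assert (x ^ n <> 0) by now apply pow_nonzero.
      rewrite pow_add, pow_1; revert E; generalize ((-1) ^ n); intros p E.
      field [E]; split; assumption.
    + rewrite sum_n_m_zero by lia; unfold zero; simpl; ring.
    + intros k Hk; destruct k as [|m]; [lia|].
      replace (S (S m) - 1)%nat with (S m) by lia.
      replace (S m - 1)%nat with m by lia.
      pose proof (pos_INR m).
      rewrite bracket3_step, !S_INR.
      (* Both powers of -x are expressed through (-1)^m x^m, as in the extra term of
         [bracket3_step]. *)
      replace ((- x) ^ S (S m)) with ((-1) ^ m * x ^ m * x * x)
        by (change ((- x) ^ S (S m)) with (- x * (- x * (- x) ^ m));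
            replace (- x) with (-1 * x) by ring;
            rewrite Rpow_mult_distr; ring).
      replace ((- x) ^ S m) with (- ((-1) ^ m * x ^ m * x))
        by (change ((- x) ^ S m) with (- x * (- x) ^ m);
            replace (- x) with (-1 * x) by ring;
            rewrite Rpow_mult_distr; ring).
      simpl pow; field; lra.
Qed.
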